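(* Let $(B,+_B,\cdot,\neg)$ be a Boolean algebra and let $(R_B,+_{R_B},\cdot)$ be the Boolean ring induced from $B$. Then $\mathrm{Spec}(R_B)$ is homeomorphic to $\mathcal{U}(B)$.
   Context: A Boolean algebra $(B,+_B,\cdot,\neg)$ is written with join $+_B$, meet $\cdot$ and complement $\neg$, with bottom $0$ and top $1$; $x\leqslant y$ means $x+_B y=y$. The Boolean ring induced from $B$ is $R_B=B$ as a set, with the same multiplication $\cdot$ and with addition $x+_{R_B}y:=x\cdot(\neg y)+_B y\cdot(\neg x)$. For a commutative ring $R$ with identity, $\mathrm{Spec}(R)$ is the set of prime ideals of $R$ with the Zariski topology, i.e. the topology having as a basis the sets $V_x=\{P\in\mathrm{Spec}(R):x\notin P\}$, $x\in R$. A filter of $B$ is a nonempty subset $F\subset B$ closed under $\cdot$ and upward closed for $\leqslant$; it is proper if $F\neq B$. An ultrafilter of $B$ is a proper filter $F$ such that for every $x\in B$ exactly one of $x,\neg x$ lies in $F$. $\mathcal{U}(B)$ denotes the set of all ultrafilters of $B$, with the topology having as a basis the sets $U_x=\{F\in\mathcal{U}(B):x\in F\}$, $x\in B$. *)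

(* Defs.v *)
From HB Require Import structures.
From mathcomp Require Import all_boot all_order all_algebra.
From mathcomp Require Import all_classical topology_structure.

Set Implicit Arguments.
Unset Strict Implicit.
Unset Printing Implicit Defensive.

Import Order.Theory GRing.Theory.
Local Open Scope classical_set_scope.

Definition homeomorphic (X Y : topologicalType) : Prop :=
  exists (f : X -> Y) (g : Y -> X),
    [/\ cancel f g, cancel g f, continuous f & continuous g].

(* The degenerate algebra with \bot = \top is allowed, so the induced ring may
   be the zero ring: hence comPzRingType rather than comNzRingType, and a
   definition of prime ideals that does not rely on ring_quotient (which is
   restricted to nonzero rings and boolean predicates). *)

Section BooleanRing.
Local Open Scope order_scope.
Context {d : Order.disp_t} (B : ctbDistrLatticeType d).

Definition boolean_ring : Type := B.

Definition bring_add (x y : B) : B := (x `&` ~` y) `|` (y `&` ~` x).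

Let addC : commutative bring_add.
Proof. by move=> x y; rewrite /bring_add joinC. Qed.

Let compl_add (x y : B) : ~` (bring_add x y) = (x `&` y) `|` (~` x `&` ~` y).
Proof.
rewrite /bring_add complU !complI !complK meetUl !meetUr.
by rewrite [_ `&` x]meetC meetxC meetxC join0x joinx0 joinC [y `&` x]meetC.
Qed.

Let addE (x y z : B) : bring_add x (bring_add y z) =
  ((x `&` y `&` z) `|` (x `&` ~` y `&` ~` z)) `|`
  ((~` x `&` y `&` ~` z) `|` (~` x `&` ~` y `&` z)).
Proof.
rewrite {1}/bring_add compl_add meetUr !meetA; congr (_ `|` _).
rewrite /bring_add meetUl; congr (_ `|` _); first by rewrite meetC meetA.
by rewrite meetC [z `&` _]meetC meetA.
Qed.

Let addA : associative bring_add.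
Proof.
move=> x y z; rewrite [RHS]addC !addE.
rewrite -!meetA ![z `&` _]meetC ![~` z `&` _]meetC !meetA -!joinA.
by congr (_ `|` _); rewrite joinA joinC.
Qed.

Let add0 : left_id (\bot : B) bring_add.
Proof. by move=> x; rewrite /bring_add meet0x join0x compl0 meetx1. Qed.

Let addN : left_inverse (\bot : B) id bring_add.
Proof. by move=> x; rewrite /bring_add meetxC joinxx. Qed.

Let mulDl : left_distributive (@Order.meet d B) bring_add.
Proof.
move=> x y z; rewrite /bring_add !complI !meetUr meetUl.
rewrite -[x `&` z `&` ~` z]meetA -[y `&` z `&` ~` z]meetA !meetxC !meetx0.
by rewrite !joinx0 ![_ `&` z `&` _]meetAC.
Qed.

HB.instance Definition _ := Choice.on boolean_ring.
HB.instance Definition _ := GRing.isZmodule.Build boolean_ring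
  addA addC add0 addN.
HB.instance Definition _ := GRing.Zmodule_isComPzRing.Build boolean_ring
  (@meetA d B) (@meetC d B) (@meet1x d B) mulDl.

End BooleanRing.

Section Spectrum.
Local Open Scope ring_scope.
Context (R : comPzRingType).

Definition is_ideal (I : set R) : Prop :=
  [/\ I 0, forall x y, I x -> I y -> I (x + y)
    & forall a x, I x -> I (a * x)].

Definition is_prime_ideal (P : set R) : Prop :=
  [/\ is_ideal P, P <> setT & forall x y, P (x * y) -> P x \/ P y].

Record Spec : Type := MkSpec
  { spec_set : set R; spec_prime : is_prime_ideal spec_set }.

HB.instance Definition _ := gen_eqMixin Spec.
HB.instance Definition _ := gen_choiceMixin Spec.

Definition spec_basic (x : R) : set Spec := [set P : Spec | ~ spec_set P x].

Let spec_cover : \bigcup_(A in range spec_basic) A = setT.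
Proof.
apply/seteqP; split=> // P _; exists (spec_basic 1); first by exists 1.
case: (spec_prime P) => -[_ _ PM] PT _ /= P1; apply: PT.
by apply/seteqP; split=> // x _; rewrite -[x]mulr1; exact: PM.
Qed.

Let spec_join (U V : set Spec) (P : Spec) :
  range spec_basic U -> range spec_basic V -> U P -> V P ->
  exists W, [/\ range spec_basic W, W P & W `<=` U `&` V].
Proof.
move=> [x _ <-] [y _ <-] Px Py; exists (spec_basic (x * y)); split.
- by exists (x * y).
- by case: (spec_prime P) => _ _ Pp /Pp[].
- move=> Q; case: (spec_prime Q) => -[_ _ QM] _ _ Qxy; split=> Qz; apply: Qxy.
    by rewrite mulrC; exact: QM.
  exact: QM.
Qed.

HB.instance Definition _ :=
  isBaseTopological.Build Spec (D := range spec_basic) spec_cover spec_join.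

End Spectrum.

Section Ultrafilters.
Local Open Scope order_scope.
Context {d : Order.disp_t} (B : ctbDistrLatticeType d).

Definition is_filter (F : set B) : Prop :=
  [/\ F !=set0, forall x y, F x -> F y -> F (x `&` y)
    & forall x y, F x -> x <= y -> F y].

Definition is_ultrafilter (F : set B) : Prop :=
  [/\ is_filter F, F <> setT
    & forall x, (F x /\ ~ F (~` x)) \/ (~ F x /\ F (~` x))].

Record Ultra : Type := MkUltra
  { ultra_set : set B; ultra_ultrafilter : is_ultrafilter ultra_set }.

HB.instance Definition _ := gen_eqMixin Ultra.
HB.instance Definition _ := gen_choiceMixin Ultra.

Definition ultra_basic (x : B) : set Ultra := [set F : Ultra | ultra_set F x].

Let ultra_cover : \bigcup_(A in range ultra_basic) A = setT.
Proof.
apply/seteqP; split=> // F _.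
case: (ultra_ultrafilter F) => -[[x Fx] _ _] _ _.
by exists (ultra_basic x) => //; exists x.
Qed.

Let ultra_join (U V : set Ultra) (F : Ultra) :
  range ultra_basic U -> range ultra_basic V -> U F -> V F ->
  exists W, [/\ range ultra_basic W, W F & W `<=` (U `&` V)%classic].
Proof.
move=> [x _ <-] [y _ <-] Fx Fy; exists (ultra_basic (x `&` y)); split.
- by exists (x `&` y).
- by case: (ultra_ultrafilter F) => -[_ FI _] _ _; exact: FI.
- move=> G; case: (ultra_ultrafilter G) => -[_ _ GU] _ _ Gxy.
  by split; apply: GU Gxy _; rewrite ?leIl ?leIr.
Qed.

HB.instance Definition _ :=
  isBaseTopological.Build Ultra (D := range ultra_basic) ultra_cover ultra_join.

End Ultrafilters.

(* Main.v *)
Require Import Defs.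
From HB Require Import structures.
From mathcomp Require Import all_boot all_order all_algebra.
From mathcomp Require Import all_classical topology_structure.

(** The homeomorphism is set complementation.  In the induced Boolean ring the
    product is the meet, so divisibility of [x] by [y] is [x <= y]: being stable
    under multiplication by arbitrary elements is being downward closed, which is
    what the complement of a filter satisfies.  Primality of [P] says that
    the complement of [P] is stable under meets.  Finally [x * ~ x = 0] and
    [x + ~ x = 1], so a prime ideal contains at least one of [x] and [~ x]
    because it contains 0, and at most one because it omits 1: its complement is
    an ultrafilter ([is_ultrafilter_setC]).  The converse
    ([is_prime_ideal_setC]) rests on [x + y] lying below the join of [x] and
    [y], and on an ultrafilter being prime for joins.

    For the topologies, [P] belongs to the basic open set of [x] in the spectrum
    iff [x] is not in [P], that is, iff the complement of [P] belongs to the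
    basic open set of [x] in the ultrafilter space.  Complementation thus matches
    the two bases index by index, hence is continuous in both directions. *)

Set Implicit Arguments.
Unset Strict Implicit.
Unset Printing Implicit Defensive.

Import Order.Theory GRing.Theory.
Local Open Scope classical_set_scope.

Lemma Spec_eq (R : comPzRingType) (P Q : Spec R) :
  spec_set P = spec_set Q -> P = Q.
Proof.
case: P Q => [P hP] [Q hQ] /= PQ; case: _ / PQ hQ => hQ.
by rewrite (Prop_irrelevance hP hQ).
Qed.

Lemma Ultra_eq (d : Order.disp_t) (B : ctbDistrLatticeType d) (F G : Ultra B) :
  ultra_set F = ultra_set G -> F = G.
Proof.
case: F G => [F hF] [G hG] /= FG; case: _ / FG hG => hG.
by rewrite (Prop_irrelevance hF hG).
Qed.

(** Indexing by ring elements rather than by basic open sets lets the same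
    index set describe an open set and its preimage under a map matching the
    bases. *)
Lemma open_SpecP (R : comPzRingType) (A : set (Spec R)) :
  open A <-> exists S : set R, A = \bigcup_(x in S) spec_basic x.
Proof.
split=> [[D' sD <-]|[S ->]].
  exists [set x | D' (spec_basic x)]; apply/seteqP; split=> P.
    by move=> [U DU UP]; have [x _ xU] := sD _ DU; exists x; rewrite /= xU.
  by move=> [x Dx xP]; exists (spec_basic x).
exists (@spec_basic R @` S); first by move=> _ [x _ <-]; exists x.
by rewrite bigcup_image.
Qed.

Lemma open_UltraP (d : Order.disp_t) (B : ctbDistrLatticeType d)
    (A : set (Ultra B)) :
  open A <-> exists S : set B, A = \bigcup_(x in S) ultra_basic x.
Proof.
split=> [[D' sD <-]|[S ->]].
  exists [set x | D' (ultra_basic x)]; apply/seteqP; split=> F.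
    by move=> [U DU UF]; have [x _ xU] := sD _ DU; exists x; rewrite /= xU.
  by move=> [x Dx xF]; exists (ultra_basic x).
exists (@ultra_basic d B @` S); first by move=> _ [x _ <-]; exists x.
by rewrite bigcup_image.
Qed.

Section Complementation.
Local Open Scope order_scope.
Context {d : Order.disp_t} (B : ctbDistrLatticeType d).

Lemma bring_add_le_join (x y : B) : bring_add x y <= x `|` y.
Proof. by rewrite /bring_add leU2 ?leIl. Qed.

Lemma bring_add_compl (x : B) : bring_add x (~` x) = \top.
Proof. by rewrite /bring_add complK !meetxx joinxC. Qed.

Lemma is_ultrafilter_setC (P : set (boolean_ring B)) :
  is_prime_ideal P -> is_ultrafilter (setC P : set B).
Proof.
move=> [[P0 PD PM] PT Pp].
have P1 : ~ P (\top : B).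
  move=> P1; apply: PT; apply/seteqP; split=> // x _.
  by have := PM x _ P1; rewrite /GRing.mul /= meetx1.
split.
- split.
  + by exists (\top : B).
  + by move=> x y nPx nPy /Pp[].
  + move=> x y nPx le_xy Py; apply: nPx.
    by have := PM x _ Py; rewrite /GRing.mul /= (meet_l le_xy).
- by move=> PCT; have : setC P (\bot : B) by rewrite PCT.
- move=> x.
  have PVnP : P x \/ P (~` x : B).
    by apply: Pp; rewrite /GRing.mul /= meetxC; exact: P0.
  have nPx2 : ~ (P x /\ P (~` x : B)).
    move=> [Px Pnx]; apply: P1.
    by have := PD _ _ Px Pnx; rewrite /GRing.add /= bring_add_compl.
  by rewrite /setC /=; case: PVnP => ?; [right|left]; split; tauto.
Qed.

Lemma ultrafilter_bot (F : set B) : is_ultrafilter F -> ~ F \bot.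
Proof.
move=> [[_ _ FU] FT _] F0; apply: FT; apply/seteqP; split=> // x _.
exact: FU F0 (le0x x).
Qed.

Lemma ultrafilter_join (F : set B) (x y : B) :
  is_ultrafilter F -> F (x `|` y) -> F x \/ F y.
Proof.
move=> uF Fxy; have F0 := ultrafilter_bot uF.
case: uF => -[_ FI _] _ Fx.
case: (Fx x) => -[]; first by left.
case: (Fx y) => -[]; first by right.
move=> _ Fny _ Fnx; case: F0; rewrite -(meetxC (x `|` y)) complU.
by apply: (FI) => //; exact: FI.
Qed.

Lemma is_prime_ideal_setC (F : set B) :
  is_ultrafilter F -> is_prime_ideal (setC F : set (boolean_ring B)).
Proof.
move=> uF; case: (uF) => -[[x0 Fx0] FI FU] _ _.
split.
- split.
  + exact: ultrafilter_bot.
  + move=> x y nFx nFy Fxy.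
    by case: (ultrafilter_join uF (FU _ _ Fxy (bring_add_le_join x y))).
  + by move=> a x nFx Fax; apply: nFx; apply: FU Fax _; exact: leIr.
- by move=> FCT; have : setC F x0 by rewrite FCT.
- move=> x y nFxy; apply/not_andP => -[Fx Fy]; apply: nFxy; exact: FI.
Qed.

Definition ultra_of_spec (P : Spec (boolean_ring B)) : Ultra B :=
  MkUltra (is_ultrafilter_setC (spec_prime P)).

Definition spec_of_ultra (F : Ultra B) : Spec (boolean_ring B) :=
  MkSpec (is_prime_ideal_setC (ultra_ultrafilter F)).

Lemma ultra_of_specK : cancel ultra_of_spec spec_of_ultra.
Proof. by move=> P; apply: Spec_eq; exact: setCK. Qed.

Lemma spec_of_ultraK : cancel spec_of_ultra ultra_of_spec.
Proof. by move=> F; apply: Ultra_eq; exact: setCK. Qed.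

Lemma ultra_of_spec_continuous : continuous ultra_of_spec.
Proof.
apply/continuousP => A /open_UltraP[S ->]; apply/open_SpecP; exists S.
exact: preimage_bigcup.
Qed.

Lemma preimage_spec_basic (x : B) :
  spec_of_ultra @^-1` spec_basic (x : boolean_ring B) = ultra_basic x.
Proof. by apply/seteqP; split=> F; [exact: contrapT | move=> Fx; apply]. Qed.

Lemma spec_of_ultra_continuous : continuous spec_of_ultra.
Proof.
apply/continuousP => A /open_SpecP[S ->]; apply/open_UltraP; exists S.
by rewrite preimage_bigcup; apply: eq_bigcupr => x _; exact: preimage_spec_basic.
Qed.

End Complementation.

Theorem theorem5p11 (d : Order.disp_t) (B : ctbDistrLatticeType d) :
  homeomorphic (Spec (boolean_ring B)) (Ultra B).
Proof.
exists (@ultra_of_spec d B), (@spec_of_ultra d B); split.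
- exact: ultra_of_specK.
- exact: spec_of_ultraK.
- exact: ultra_of_spec_continuous.
- exact: spec_of_ultra_continuous.
Qed.
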